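(* Let $N\ge1$ be an integer and assume the prime $2N$-tuplets conjecture TC($2N$). Let $s\ge 1$ and let $g_1,\dots,g_s$ be integers different from $-1,0,1$. Suppose that for every choice of $e_1,\dots,e_s\in\{0,1\}$ with $e_1+\dots+e_s$ odd, the product $\prod_{i=1}^s g_i^{e_i}$ is not a perfect square. Suppose furthermore that for each $i$ the discriminant of the field $\mathbb Q(\sqrt{g_i})$ is not divisible by $3$. Then there exist integers $A$ and $C$ such that $p(j)=Aj^2+C$ is prime for $1\le j\le N$ and each of $g_1,\dots,g_s$ is a primitive root modulo $p(j)$ for every $1\le j\le N$.
   Context: TC($k$) is the statement: for all integers $A_1,\dots,A_k,B_1,\dots,B_k$ with $A_j>0$ such that for every prime $p$ there is an integer $n_p$ with $p\nmid\prod_{j=1}^k(A_jn_p+B_j)$, there exist infinitely many integers $n$ such that $A_jn+B_j$ is prime for all $1\le j\le k$. *)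

(* Defs.v *)
From HB Require Import structures.
From mathcomp Require Import all_boot all_order all_algebra.
From mathcomp Require Import all_fingroup all_solvable all_field.
From mathcomp Require Import classical_sets cardinality.
Set Implicit Arguments.
Unset Strict Implicit.
Unset Printing Implicit Defensive.
Import Order.TTheory GRing.Theory Num.Theory.
Local Open Scope ring_scope.

(* Prime numbers are positive: -3 is not prime here. *)
Definition primez (z : int) : bool := (0 < z) && prime `|z|%N.

Definition TC (k : nat) : Prop :=
  forall A B : 'I_k -> int,
    (forall j, 0 < A j) ->
    (forall p : nat, prime p ->
       exists n : int, ~~ (p%:Z %| \prod_(j < k) (A j * n + B j))%Z) ->
    infinite_set [set n : int | forall j : 'I_k, primez (A j * n + B j)]%classic.

(* ['F_p] is the field of integers mod p only when p is prime. *)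
Definition primitive_root_mod (g : int) (p : nat) : Prop :=
  exists2 u : {unit 'F_p},
    FinRing.uval u = g%:~R & generator [set: {unit 'F_p}] u.

Definition perfect_square (z : int) : Prop := exists m : int, z = m ^+ 2.

(* Trace of multiplication by x, read off a basis of L over Q. *)
Definition field_trace (L : fieldExtType rat) (x : L) : rat :=
  \sum_(i < \dim {:L})
    coord (vbasis {:L}) i (x * (vbasis {:L})`_i).

Definition integral_basis (L : fieldExtType rat)
    (b : (\dim {:L}).-tuple L) : Prop :=
  basis_of {:L} b /\
  forall x : L, integralOver (intr : int -> L) x <-> inIntSpan b x.

Definition is_discriminant (L : fieldExtType rat) (D : int) : Prop :=
  exists2 b : (\dim {:L}).-tuple L, integral_basis b &
    D%:~R = \det (\matrix_(i < \dim {:L}, j < \dim {:L})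
                    field_trace (b`_i * b`_j)).

(* D is the discriminant of a field obtained from Q by adjoining a square root
   of g; such fields are all isomorphic, so D is determined by g. *)
Definition sqrt_field_discriminant (g D : int) : Prop :=
  exists (L : fieldExtType rat) (z : L),
    [/\ z ^+ 2 = g%:~R, <<1; z>>%VS = {:L}%VS & is_discriminant L D].

(* Main.v *)
(* If p = 2^a q + 1 is a large prime with q prime, then every integer g other than
   -1, 0, 1 which is a nonresidue mod p is a primitive root: its order divides
   2^a q, but neither (p-1)/2 nor 2^a.  So it suffices to find a class c mod M
   in which all primes p make every g i a nonresidue, and such that c is neither
   0 nor 1 modulo the odd primes dividing M while (c-1)/2^a is odd: TC(2N), applied
   to the forms p(j) = M n + M j^2 + c and (p(j)-1)/2^a in n, with M divisible by
   all primes <= 2N, then gives a large n, and A = M, C = M n + c.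

   Prescribing the symbols (-1/p), (2/p) and (l/p) for the primes l >= 5 amounts
   to prescribing c mod 16 (where a = 1, 2 or 3) and, by quadratic reciprocity, the
   quadratic character of c mod l; both values are taken by some c other than 0, 1
   mod l (for the value 1, take c = 4).  Modulo 3 only c = 2 is left, so
   (3/p) cannot be prescribed: this is harmless because g i has even 3-adic
   valuation, as otherwise 3 would divide the discriminant
   of Q(sqrt (g i)), which is t^2 * g i for a rational t.  The
   required symbols exist by linear algebra over F_2: the system is solvable as
   soon as a product of the g i which is a square has an even number of
   factors. *)
Require Import Defs.
From mathcomp Require Import all_boot all_order all_algebra.
From mathcomp Require Import all_fingroup all_solvable all_field.
From mathcomp Require Import boolp classical_sets functions cardinality.
From mathcomp Require Import ring zify.
Set Implicit Arguments.
Unset Strict Implicit.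
Unset Printing Implicit Defensive.
Import Order.TTheory GRing.Theory Num.Theory.
Local Open Scope ring_scope.

(** * Quadratic reciprocity *)

(** The Legendre symbol, with Euler's criterion taken as definition. Its values are integers so that
    they can be cast both into ['F_l] and into a field of another characteristic. *)
Definition qchar (l : nat) (a : 'F_l) : int :=
  if a == 0 then 0 else if a ^+ l./2 == 1 then 1 else -1.

Section QuadraticCharacter.
Variable l : nat.
Hypotheses (pr_l : prime l) (odd_l : odd l).

Lemma half_odd : l = (l./2.*2).+1.
Proof. by rewrite -{1}(odd_double_half l) odd_l. Qed.

Lemma half_odd_prime_gt0 : (0 < l./2)%N.
Proof. by case: l pr_l odd_l => [|[|[|]]]. Qed.

Lemma Fp_nat_eq0 (n : nat) : (n%:R == 0 :> 'F_l) = (l %| n)%N.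
Proof. by rewrite (dvdn_pcharf (pchar_Fp pr_l)). Qed.

Lemma Fp_N1_neq1 : -1 != 1 :> 'F_l.
Proof.
rewrite eq_sym -addr_eq0 -[1 + 1]/(2%:R) Fp_nat_eq0.
apply/negP => /(dvdn_leq (isT : (0 < 2)%N)).
by case: l pr_l odd_l => [|[|[|]]].
Qed.

Lemma Fp_expf_half (a : 'F_l) : a != 0 ->
  (a ^+ l./2 == 1) || (a ^+ l./2 == -1).
Proof.
move=> a0; rewrite -eqf_sqr expr1n -exprM muln2.
have E : a ^+ (l./2.*2).+1 = a * 1 by rewrite -half_odd mulr1 -[RHS]expf_card card_Fp.
by move: E; rewrite exprS => /(mulfI a0) ->.
Qed.

Lemma qcharE (a : 'F_l) : (qchar a)%:~R = a ^+ l./2.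
Proof.
rewrite /qchar; case: eqP => [->|/eqP a0].
  by rewrite expr0n eqn0Ngt half_odd_prime_gt0.
case: eqP => [->//|/eqP a1]; have := Fp_expf_half a0.
by rewrite (negPf a1) => /eqP->.
Qed.

Lemma qchar_sign (a : 'F_l) : a != 0 -> exists b : bool, qchar a = (-1) ^+ b.
Proof.
by move=> a0; rewrite /qchar (negPf a0); case: eqP => _; [exists false|exists true].
Qed.

Lemma sign_Fp_inj (b c : bool) : (-1) ^+ b = (-1) ^+ c :> 'F_l -> b = c.
Proof.
case: b; case: c => // E; have := Fp_N1_neq1;
  by rewrite -[-1]expr1 -[1]/((-1) ^+ 0) ?E -?E eqxx.
Qed.

Lemma qcharM (a b : 'F_l) : qchar (a * b) = qchar a * qchar b.
Proof.
have [->|a0] := eqVneq a 0; first by rewrite mul0r /qchar eqxx mul0r.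
have [->|b0] := eqVneq b 0; first by rewrite mulr0 /qchar eqxx mulr0.
have [x Ex] := qchar_sign a0; have [y Ey] := qchar_sign b0.
have [|z Ez] := @qchar_sign (a * b); first by rewrite mulf_neq0.
have := qcharE (a * b); rewrite exprMn -!qcharE Ex Ey Ez -intrM -signr_addb.
by rewrite !rmorph_sign => E; rewrite (sign_Fp_inj E).
Qed.

Lemma qcharN1 : qchar (-1 : 'F_l) = (-1) ^+ l./2.
Proof.
have [|z Ez] := @qchar_sign (-1); first by rewrite oppr_eq0 oner_neq0.
have := qcharE (-1); rewrite Ez -[RHS]signr_odd rmorph_sign => /sign_Fp_inj->.
by rewrite signr_odd.
Qed.

Lemma qchar_sqr (a : 'F_l) : a != 0 -> qchar a ^+ 2 = 1.
Proof. by move=> /qchar_sign[b ->]; rewrite sqrr_sign. Qed.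

(** The polynomial ['X^(l./2) - 1] has too few roots to vanish at all l - 1 nonzero elements. *)
Lemma Fp_nonresidue : exists2 a : 'F_l, a != 0 & qchar a = -1.
Proof.
pose rs := enum (predC1 (0 : 'F_l)).
have [/allP H|/allPn[a]] := boolP (all (root ('X^(l./2) - 1 : {poly 'F_l})) rs).
  have /max_poly_roots/(_ (introT allP H) (enum_uniq _)) : ('X^(l./2) - 1 : {poly 'F_l}) != 0.
    by rewrite -size_poly_gt0 size_XnsubC ?half_odd_prime_gt0.
  rewrite size_XnsubC ?half_odd_prime_gt0 // -cardE cardC1 card_Fp //.
  by have := half_odd; have := half_odd_prime_gt0; lia.
rewrite mem_enum /= inE => a0.
rewrite /root !hornerE subr_eq0 => a1; exists a => //.
by rewrite /qchar (negPf a0) (negPf a1).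
Qed.

(** Multiplication by a nonresidue permutes the summands and changes their sign. *)
Lemma sum_qchar : \sum_(a : 'F_l) qchar a = 0.
Proof.
have [n n0 En] := Fp_nonresidue.
have E : \sum_(a : 'F_l) qchar a = - \sum_(a : 'F_l) qchar a.
  rewrite {1}(reindex_inj (mulfI n0)) /= -sumrN; apply: eq_bigr => a _.
  by rewrite qcharM En mulN1r.
lia.
Qed.

(** * Quadratic Gauss sums in characteristic p *)

Section GaussSum.
Variables (p : nat) (K : fieldType) (z : K).
Hypotheses (pr_p : prime p) (odd_p : odd p) (chK : p \in [pchar K]).
Hypotheses (neq_pl : p != l) (prim_z : l.-primitive_root z).

(** The additive character of ['F_l] attached to the l-th root of unity [z]; the exponent is the
    representative of [a] in [0, l). *)
Let psi (a : 'F_l) : K := z ^+ a.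

Lemma psi_nat n : psi n%:R = z ^+ n.
Proof. by rewrite /psi val_Fp_nat // prim_expr_mod. Qed.

Lemma Fp_natP (a : 'F_l) : exists n : nat, a = n%:R.
Proof. by exists a; rewrite natr_Zp. Qed.

Lemma psiD a b : psi (a + b) = psi a * psi b.
Proof.
have [n ->] := Fp_natP a; have [m ->] := Fp_natP b.
by rewrite -natrD !psi_nat exprD.
Qed.

Lemma psi_pchar a : psi a ^+ p = psi (a * p%:R).
Proof.
by have [n ->] := Fp_natP a; rewrite -natrM !psi_nat exprM.
Qed.

(** For [t != 0] the sum runs over all values of [psi]; the shift a -> 1 + a multiplies it by [z],
    and [z != 1]. *)
Lemma sum_psi (t : 'F_l) : \sum_a psi (a * t) = if t == 0 then l%:R else 0.
Proof.
case: eqP => [->|/eqP t0].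
  rewrite (eq_bigr (fun _ => 1)) => [|a _]; last by rewrite mulr0 /psi expr0.
  by rewrite sumr_const card_Fp.
have -> : \sum_a psi (a * t) = \sum_a psi a.
  by rewrite [RHS](reindex_inj (mulIf t0)).
have E : \sum_a psi a = z * \sum_a psi a.
  rewrite {1}(reindex_inj (addrI 1)) mulr_sumr; apply: eq_bigr => a _.
  by rewrite psiD -[1]/(1%:R) psi_nat expr1.
have z1 : z != 1 by rewrite -[z]expr1 -(prim_order_dvd prim_z) dvdn1; case: l pr_l => [|[]].
apply/eqP; have /eqP := E; rewrite -subr_eq0 -{1}[\sum_a _]mul1r -mulrBl mulf_eq0.
by rewrite subr_eq0 eq_sym (negPf z1).
Qed.

Definition gauss_sum : K := \sum_a (qchar a)%:~R * psi a.

(** Writing the second summation variable as a t turns the square into a double sum of qchar(t)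
    psi(a (1 + t)) over a != 0; summation over a singles out t = -1. *)
Lemma gauss_sum_sqr : gauss_sum ^+ 2 = (-1) ^+ l./2 * l%:R.
Proof.
have -> : gauss_sum ^+ 2 =
    \sum_(a : 'F_l) \sum_(t : 'F_l) (qchar a ^+ 2 * qchar t)%:~R * psi (a * (1 + t)).
  rewrite expr2 {1}/gauss_sum mulr_suml; apply: eq_bigr => a _.
  have [->|a0] := eqVneq a 0.
    by rewrite /qchar eqxx !mul0r big1 // => t _; rewrite expr0n !mul0r.
  rewrite /gauss_sum (reindex_inj (mulfI a0)) mulr_sumr; apply: eq_bigr => t _.
  by rewrite qcharM mulrDr mulr1 psiD !rmorphM /=; ring.
rewrite exchange_big /=.
(* Since [qchar] vanishes at 0, the inner sum is the complete sum of [sum_psi] minus its term 1 at a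
   = 0. *)
transitivity (\sum_(t : 'F_l) (qchar t)%:~R * ((if 1 + t == 0 then l%:R else 0) - 1) : K).
  apply: eq_bigr => t _; rewrite -sum_psi mulrBr mulr1 mulr_sumr.
  rewrite (bigD1 0) //= [in RHS](bigD1 0) //= /qchar eqxx expr0n !mul0r add0r.
  rewrite /psi expr0 mulr1 addrAC subrr add0r; apply: eq_bigr => a a0.
  by rewrite (_ : (if a == 0 then _ else _) ^+ 2 = 1) ?mul1r //; exact: (qchar_sqr a0).
under eq_bigr do rewrite mulrBr mulr1.
rewrite sumrB -rmorph_sum sum_qchar subr0 (bigD1 (-1)) //= subrr eqxx big1 ?addr0.
  by rewrite qcharN1 rmorph_sign.
by move=> t tN1; rewrite addrC addr_eq0 (negPf tN1) mulr0.
Qed.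

(** Frobenius fixes the integers [qchar a] and sends psi(a) to psi(a p); the substitution a -> a p
    then extracts the factor qchar(p). *)
Lemma gauss_sum_pow : gauss_sum ^+ p = (qchar (p%:R : 'F_l))%:~R * gauss_sum.
Proof.
have p0 : (p%:R : 'F_l) != 0 by rewrite Fp_nat_eq0 dvdn_prime2 // eq_sym.
rewrite -(pFrobenius_autE chK) /gauss_sum rmorph_sum mulr_sumr.
rewrite [RHS](reindex_inj (mulIf p0)); apply: eq_bigr => a _ /=.
rewrite pFrobenius_autE exprMn psi_pchar -(pFrobenius_autE chK) rmorph_int.
rewrite qcharM rmorphM /= !mulrA; congr (_ * _).
by rewrite mulrC mulrA -expr2 -rmorphXn /= qchar_sqr // mul1r.
Qed.

(** Compare two expressions for the p-th power of the Gauss sum: the Frobenius one, and its square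
    raised to (p-1)/2 times itself. The Gauss sum can be cancelled because l is nonzero in
    characteristic p. *)
Lemma gauss_sum_euler : ((-1) ^+ l./2 * l%:R) ^+ p./2 = (qchar (p%:R : 'F_l))%:~R :> K.
Proof.
have tau0 : gauss_sum != 0.
  rewrite -sqrf_eq0 gauss_sum_sqr mulf_eq0 signr_eq0 /=.
  by rewrite -(dvdn_pcharf chK) dvdn_prime2.
apply: (mulIf tau0); rewrite -gauss_sum_pow -gauss_sum_sqr -exprM -exprSr.
by rewrite mul2n -[in RHS](odd_double_half p) odd_p.
Qed.
End GaussSum.
End QuadraticCharacter.

(** * Reciprocity and the quadratic character of 2 in F_p *)

Lemma finField_prim_root (K : finFieldType) (n : nat) :
  (0 < n)%N -> (n %| #|K|.-1)%N -> exists z : K, n.-primitive_root z.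
Proof.
move=> n0 dv.
have K1 : (0 < #|K|.-1)%N 
  by rewrite -ltnS prednK ?finNzRing_gt1 // (ltn_trans _ (finNzRing_gt1 K)).
have /(has_prim_root K1)/(_ (enum_uniq _)) : all #|K|.-1.-unity_root (enum (predC1 (0 : K))).
  apply/allP => a; rewrite mem_enum !inE /= => a0; rewrite unity_rootE.
  have := expf_card a; rewrite -{1}(prednK (ltn_trans _ (finNzRing_gt1 K))) // exprS.
  by rewrite -{3}[a]mulr1 => /(mulfI a0) ->.
rewrite -cardE cardC1 leqnn => /(_ isT)/hasP[z _ pz].
by exists (z ^+ (#|K|.-1 %/ n)); apply: dvdn_prim_root pz _ dv.
Qed.

(** The field with p^totient(n) elements works, since n divides p^totient(n) - 1 by Euler's
    theorem. *)
Lemma pchar_prim_root (p n : nat) : prime p -> (0 < n)%N -> coprime p n ->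
  exists (K : finFieldType) (z : K), p \in [pchar K] /\ n.-primitive_root z.
Proof.
move=> pr_p n0 co.
have [K chK cardK] := pPrimePowerField pr_p (etrans (totient_gt0 n) n0).
have [|z pz] := @finField_prim_root K n n0.
  rewrite cardK -subn1 -eqn_mod_dvd ?expn_gt0 ?prime_gt0 //.
  by apply/eqP; apply: Euler_exp_totient.
by exists K, z.
Qed.

(** Brings identities between integers, proved in an extension containing roots of unity, back to
    ['F_p]. *)
Lemma pchar_intr_transfer (p : nat) (K : nzRingType) (a b : int) :
  prime p -> p \in [pchar K] -> a%:~R = b%:~R :> K -> a%:~R = b%:~R :> 'F_p.
Proof.
move=> pr_p chK /eqP; rewrite -subr_eq0 -rmorphB -(dvdz_pcharf chK).
by rewrite (dvdz_pcharf (pchar_Fp pr_p)) rmorphB subr_eq0 => /eqP.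
Qed.

Lemma quadratic_reciprocity (p l : nat) :
  prime p -> prime l -> odd p -> odd l -> p != l ->
  ((-1) ^+ l./2 * l%:R) ^+ p./2 = (qchar (p%:R : 'F_l))%:~R :> 'F_p.
Proof.
move=> pr_p pr_l odd_p odd_l neq.
have [||K [z [chK pz]]] := @pchar_prim_root p l pr_p; first exact: prime_gt0.
  by rewrite prime_coprime // dvdn_prime2.
have := gauss_sum_euler pr_l odd_l pr_p odd_p chK neq pz.
have E (R : nzRingType) :
    ((-1) ^+ l./2 * l%:R) ^+ p./2 = ((((-1) ^+ l./2 * l%:Z) ^+ p./2)%:~R : R).
  by rewrite rmorphXn rmorphM /= rmorphXn rmorphN1.
by rewrite !E; apply: pchar_intr_transfer chK.
Qed.

(** The Gauss sum argument with an eighth root of unity: tau = z + 1/z satisfies tau^2 = 2, and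
    Frobenius gives tau^p = z^p + z^(-p), which is tau or -tau according to p mod 8. *)
Lemma euler_two (p : nat) : prime p -> odd p ->
  2 ^+ p./2 = (-1) ^+ ((p %% 8)%N \in [:: 3; 5]) :> 'F_p.
Proof.
move=> pr_p odd_p.
have [||K [z [chK pz]]] := @pchar_prim_root p 8 pr_p => //.
  by rewrite (@coprime_pexpr 3 p 2) // coprimen2.
suff : 2 ^+ p./2 = (-1) ^+ ((p %% 8)%N \in [:: 3; 5]) :> K.
  have E (R : nzRingType) : 2 ^+ p./2 = ((2 ^+ p./2)%:~R : R) by rewrite rmorphXn.
  have E' (R : nzRingType) (b : bool) : (-1) ^+ b = (((-1) ^+ b)%:~R : R).
    by rewrite rmorph_sign.
  by rewrite (E K) (E 'F_p) (E' K) (E' 'F_p); apply: pchar_intr_transfer chK.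
have z8 : z ^+ 8 = 1 by apply: prim_expr_order.
have z4 : z ^+ 4 = -1.
  have : z ^+ 4 != 1 by rewrite -(prim_order_dvd pz).
  have : z ^+ 4 ^+ 2 == 1 ^+ 2 by rewrite -exprM z8 expr1n.
  by rewrite eqf_sqr => /orP[/eqP->|/eqP->//]; rewrite eqxx.
(* Here [z ^+ 7] is the inverse of [z]. *)
pose tau := z + z ^+ 7.
have tau2 : tau ^+ 2 = 2.
  have -> : tau ^+ 2 = z ^+ 2 + z ^+ 8 * 2 + z ^+ 4 * z ^+ 8 * z ^+ 2 by rewrite /tau; ring.
  by rewrite z8 z4; ring.
have n2 : (2 : K) != 0.
  rewrite -(dvdn_pcharf chK); apply/negP => /(dvdn_leq (isT : (0 < 2)%N)).
  by case: p pr_p odd_p {chK} => [|[|[|]]].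
have tau0 : tau != 0 by rewrite -sqrf_eq0 tau2.
apply: (mulIf tau0); rewrite -{1}tau2 -exprM -exprSr mul2n.
have -> : (p./2.*2).+1 = p by rewrite -{2}(odd_double_half p) odd_p.
rewrite -(pFrobenius_autE chK) /tau rmorphD rmorphXn /= pFrobenius_autE.
rewrite -(prim_expr_mod pz p).
have : odd (p %% 8)%N by rewrite odd_mod.
have : (p %% 8 < 8)%N by rewrite ltn_mod.
case: (p %% 8)%N => [|[|[|[|[|[|[|[|]]]]]]]] //= _ _; rewrite ?inE /= ?expr0 ?expr1 ?mul1r //.
- have -> : z ^+ 3 + z ^+ 3 ^+ 7 = z ^+ 3 + z ^+ 8 ^+ 2 * z ^+ 4 * z by ring.
  have -> : z + z ^+ 7 = z + z ^+ 4 * z ^+ 3 by ring.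
  by rewrite z8 z4; ring.
- have -> : z ^+ 5 + z ^+ 5 ^+ 7 = z ^+ 4 * z + z ^+ 8 ^+ 4 * z ^+ 3 by ring.
  have -> : z + z ^+ 7 = z + z ^+ 4 * z ^+ 3 by ring.
  by rewrite z8 z4; ring.
- have -> : z ^+ 7 + z ^+ 7 ^+ 7 = z ^+ 7 + z ^+ 8 ^+ 6 * z by ring.
  by rewrite z8; ring.
Qed.

(** * Discriminants of quadratic fields *)

Lemma int_of_rat_Aint (r : rat) : ratr r \in Aint -> exists k : int, r = k%:~R.
Proof.
move=> /(Cint_rat_Aint (Crat_rat _)) /intrP[k Ek]; exists k.
by apply: (fmorph_inj (ratr : rat -> algC)); rewrite /= ratr_int; exact: Ek.
Qed.

Lemma integralOver_in_alg (L : fieldExtType rat) (r : rat) :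
  integralOver (intr : int -> L) r%:A -> exists k : int, r = k%:~R.
Proof.
case=> p mp rp; apply: int_of_rat_Aint.
have rp' : root (map_poly intr p : {poly rat}) r.
  rewrite -(fmorph_root (in_alg L)) -map_poly_comp /= (eq_map_poly (_ : _ =1 intr)) //.
  by move=> k /=; rewrite -(rmorph_int (in_alg L)).
apply: (@root_monic_Aint (map_poly intr p)).
- rewrite (eq_map_poly (_ : intr =1 (ratr \o intr))) => [|k /=]; last by rewrite ratr_int.
  by rewrite map_poly_comp fmorph_root.
- exact: monic_map.
- by apply/polyOverP => i; rewrite coef_map /= intr_int.
Qed.

Lemma rat_int_of_sqr (r : rat) (n : int) : r ^+ 2 = n%:~R -> exists k : int, r = k%:~R.
Proof.
move=> E; apply: int_of_rat_Aint; apply: (@root_monic_Aint ('X^2 - n%:~R%:P)).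
- by rewrite /root !hornerE -rmorphXn E /= ratr_int subrr.
- exact: monicXnsubC.
- by rewrite polyOverXnsubC intr_int.
Qed.

(** Clearing the denominator of [t] leaves D and g multiplied by nonzero integer squares, which have
    even exponents. *)
Lemma logn_ratio (l : nat) (t : rat) (D g : int) : prime l -> g != 0 -> t != 0 ->
  D%:~R = t ^+ 2 * g%:~R -> odd (logn l `|D|) = odd (logn l `|g|).
Proof.
move=> pr_l g0 t0 E.
have q0 : denq t != 0 by exact: denq_neq0.
have n0 : numq t != 0 by rewrite numq_eq0.
have EZ : D * denq t ^+ 2 = numq t ^+ 2 * g.
  apply: (@intr_inj rat); rewrite !rmorphM /= E -{1}(divq_num_den t).
  by rewrite ?rmorphXn /=; field; rewrite ?intr_eq0.
have D0 : D != 0.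
  by apply: contraNneq (mulf_neq0 (expf_neq0 2 n0) g0) => D0; rewrite -EZ D0 mul0r.
have := congr1 (fun x => odd (logn l `|x|)) EZ.
rewrite !abszM !lognM ?muln_gt0 ?absz_gt0 ?D0 ?q0 ?n0 ?g0 //.
by rewrite !oddD !addbb addbF.
Qed.

Lemma sum_ord2 (V : nmodType) (n : nat) (F : nat -> V) : n = 2 -> \sum_(i < n) F i = F 0 + F 1.
Proof. by move->; rewrite !big_ord_recl big_ord0 addr0. Qed.

Lemma det_ord2 (R : comNzRingType) (n : nat) (F : nat -> nat -> R) : n = 2 ->
  \det (\matrix_(i < n, j < n) F i j) = F 0 0 * F 1 1 - F 0 1 * F 1 0.
Proof.
move=> ->; rewrite (expand_det_row _ ord0) !big_ord_recl big_ord0 /cofactor !det_mx11 !mxE /=.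
by rewrite /bump /= !addn0 expr0 expr1; ring.
Qed.

(** The entry (0,1) of M^2 is [M 0 1] times the trace; were the trace nonzero, [M 0 1] would vanish
    and a would be the square of [M 0 0]. *)
Lemma mxtrace_sqrt_nonsquare (F : fieldType) (n : nat) (M : 'M[F]_n) (a : F) : n = 2 ->
  (forall t, t ^+ 2 != a) -> M *m M = a%:M -> \tr M = 0.
Proof.
move=> En; subst n => nsq /matrixP E.
have := E 0 0; have := E 0 1; have := E 1 0.
rewrite !mxE !big_ord_recl !big_ord0 /= !addr0 /mxtrace !big_ord_recl big_ord0 addr0.
rewrite (_ : lift ord0 ord0 = 1); last exact/val_inj.
rewrite (_ : ord0 = 0); last exact/val_inj.
rewrite /= mulr1n => E10 E01 E00.
apply/eqP; apply: contraT => tr0.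
have /eqP : M 0 1 * (M 0 0 + M 1 1) = 0 by rewrite -[RHS]E01; ring.
rewrite mulf_eq0 (negPf tr0) orbF => /eqP M01.
by have := nsq (M 0 0); rewrite -E00 M01 mul0r addr0 expr2 eqxx.
Qed.

(** * Integral basis and discriminant of a quadratic field *)

Section QuadraticField.
Variables (g : int) (L : fieldExtType rat) (z : L).
Hypotheses (odd3 : odd (logn 3 `|g|)) (z2 : z ^+ 2 = g%:~R) (genz : <<1; z>>%VS = {:L}%VS).

Let integral (x : L) := integralOver (intr : int -> L) x.

Let g0 : g != 0. Proof. by apply: contraTneq odd3 => ->. Qed.

Let nsq (t : rat) : t ^+ 2 != g%:~R.
Proof.
apply/negP => /eqP E.
have t0 : t != 0 by apply: contraNneq g0 => t0; rewrite -(intr_eq0 rat) -E t0.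
have := @logn_ratio 3 t^-1 1 g isT g0; rewrite invr_eq0 t0 -E exprVn mulVf ?expf_neq0 //.
by rewrite odd3 logn1 => /(_ isT erefl).
Qed.

Let el (a b : rat) : L := a%:A + b%:A * z.

Let z2A : z ^+ 2 = (g%:~R : rat)%:A.
Proof. by rewrite z2 -(rmorph_int (in_alg L)). Qed.

Let algD (a b : rat) : (a + b)%:A = a%:A + b%:A :> L. Proof. exact: (rmorphD (in_alg L)). Qed.
Let algM (a b : rat) : (a * b)%:A = a%:A * b%:A :> L. Proof. exact: (rmorphM (in_alg L)). Qed.
Let algN (a : rat) : (- a)%:A = - a%:A :> L. Proof. exact: (rmorphN (in_alg L)). Qed.
Let alg_int (k : int) : (k%:~R : rat)%:A = k%:~R :> L. Proof. exact: (rmorph_int (in_alg L)). Qed.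

Let elD a b c d : el a b + el c d = el (a + c) (b + d).
Proof. by rewrite /el !algD; ring. Qed.
Let elN a b : - el a b = el (- a) (- b).
Proof. by rewrite /el !algN; ring. Qed.
Let elM a b c d : el a b * el c d = el (a * c + b * d * g%:~R) (a * d + b * c).
Proof.
rewrite /el !algD !algM -z2A; ring.
Qed.
Let el_int (k : int) : el k%:~R 0 = k%:~R.
Proof. by rewrite /el scale0r mul0r addr0 alg_int. Qed.

Let elP (x : L) : exists a b, x = el a b.
Proof.
have : x \in <<1; z>>%VS by rewrite genz memvf.
case/Fadjoin_polyP => p /polyOverP p1 ->.
rewrite horner_coef; elim/big_ind: _ => [|u v [a [b ->]] [c [d ->]]|i _].
- by exists 0, 0; rewrite (el_int 0).
- by exists (a + c), (b + d); rewrite elD.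
have /vlineP[k ->] := p1 i.
elim: (nat_of_ord i) => [|j [a [b E]]].
  by exists k, 0; rewrite expr0 mulr1 /el scale0r mul0r addr0.
exists (b * g%:~R), a; rewrite exprSr mulrA E.
have -> : z = el 0 1 by rewrite /el scale0r add0r scale1r mul1r.
by rewrite elM; congr el; ring.
Qed.

Let el_eq0 a b : el a b = 0 -> a = 0 /\ b = 0.
Proof.
have [->|b0] := eqVneq b 0.
  by rewrite /el scale0r mul0r addr0 => /eqP; rewrite scaler_eq0 oner_eq0 orbF => /eqP.
move=> E; case/eqP: (nsq (- (a / b))).
apply: (fmorph_inj (in_alg L)) => /=; rewrite -z2A expr2 algM -expr2; congr (_ ^+ 2).
have bA : b%:A != 0 :> L by rewrite scaler_eq0 oner_eq0 orbF.
apply: (mulfI bA); rewrite -algM mulrN mulrCA divff // mulr1 algN.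
by apply/esym/eqP; rewrite -addr_eq0 addrC -/(el a b) E.
Qed.

(** An integer polynomial takes conjugate values at conjugate elements, so the conjugate is a root
    of the same monic polynomial. *)
Let integral_conj a b : integral (el a b) -> integral (el a (- b)).
Proof.
case=> p mp rp; exists p => //.
have [P [Q [E1 E2]]] : exists P Q, (map_poly intr p).[el a b] = el P Q /\
    (map_poly intr p).[el a (- b)] = el P (- Q).
  elim/poly_ind: (p) => [|q c [P [Q [E1 E2]]]].
    by exists 0, 0; rewrite rmorph0 !horner0 oppr0 (el_int 0).
  exists (P * a + Q * b * g%:~R + c%:~R), (P * b + Q * a).
  rewrite rmorphD rmorphM /= map_polyX map_polyC /= !hornerMXaddC E1 E2 -el_int !elM !elD.
  by split; congr el; ring.
move: rp; rewrite /root E1 E2 => /eqP /el_eq0[-> ->].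
by rewrite oppr0 (el_int 0).
Qed.

Let integral_trace_norm a b : integral (el a b) ->
  (exists u : int, 2 * a = u%:~R) /\ (exists n : int, a ^+ 2 - b ^+ 2 * g%:~R = n%:~R).
Proof.
move=> Ix; have Iy := integral_conj Ix.
split; apply: (@integralOver_in_alg L).
  have -> : (2 * a)%:A = el a b + el a (- b).
    by rewrite elD /el subrr scale0r mul0r addr0; congr (_ *: _); ring.
  exact: integral_add.
have -> : (a ^+ 2 - b ^+ 2 * g%:~R)%:A = el a b * el a (- b).
  rewrite elM /el (_ : a * - b + b * a = 0); last by ring.
  by rewrite scale0r mul0r addr0; congr (_ *: _); ring.
exact: integral_mul.
Qed.

Let integral_coord a b : integral (el a b) -> exists k : int, b * (2 * g%:~R) = k%:~R.
Proof.
move=> /integral_trace_norm[[u Eu] [n En]].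
(* With u = 2a the trace and n the norm, u^2 - 4n = 4 b^2 g; multiplied by g this is the square of
   2bg. *)
apply: (@rat_int_of_sqr _ (g * (u ^+ 2 - 4 * n))).
rewrite rmorphM rmorphB /= rmorphXn /= rmorphM /= -Eu -En; ring.
Qed.

Let ratio (k : int) : rat := k%:~R / (2 * g%:~R).

(* The coefficients of z in the integral elements form a subgroup of (2g)^-1 Z
   that contains 1; an element realizing the least positive one completes 1 to a basis. *)
Let integral_basis_exists : exists al be : rat,
  [/\ integral (el al be), be != 0 &
    forall x, integral x -> exists u v : int, x = u%:~R + v%:~R * el al be].
Proof.
have g2 : 2 * g%:~R != 0 :> rat by rewrite mulf_neq0 // intr_eq0.
have sg2 : sgz g ^+ 2 = 1 by rewrite expr2 mulz_sg g0.
pose P (k : nat) := (0 < k)%N && `[< exists a, integral (el a (ratio k)) >].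
have exP : exists k, P k.
  (* The coefficient is then the sign of g, and z or -z is a root of X^2 - g. *)
  exists (2 * `|g|)%N; rewrite /P muln_gt0 absz_gt0 g0 /=; apply/asboolP; exists 0.
  have -> : ratio (2 * `|g|)%N = (sgz g)%:~R.
    rewrite /ratio PoszM rmorphM /= abszEsg rmorphM /=; field.
    by rewrite intr_eq0.
  apply: (@integral_root_monic _ _ intr _ ('X^2 - g%:~R%:P)).
  - exact: monicXnsubC.
  - rewrite /root !hornerE /el scale0r add0r alg_int exprMn z2.
    by rewrite -rmorphXn -rmorphM -rmorphB /= sg2 mul1r subrr.
  - apply/integral_poly => i; rewrite coefB coefXn coefC.
    apply: integral_sub; first exact: integral_nat.
    by case: ifP => _; [exact: (integral_id intr g) | exact: integral0].
have [m /andP[m0 /asboolP[al Iw]] minm] := ex_minnP exP.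
exists al, (ratio m); split=> //.
  by rewrite /ratio mulf_neq0 ?invr_eq0 // intr_eq0 -lt0n.
move=> x; have [a [b ->]] := elP x => Ix.
have [k Ek] := integral_coord Ix.
have Eb : b = ratio k by rewrite /ratio -Ek mulfK.
have Iv (v : int) : integral v%:~R by apply: integral_id.
(* Euclidean division by the least positive index: the remainder also comes from an integral
   element, so it is 0 by minimality, and what is left is a rational integral element. *)
pose v := (k %/ m%:Z)%Z; pose r := (k %% m%:Z)%Z.
have r0 : 0 <= r by apply: modz_ge0; lia.
have rm : r < m%:Z by rewrite /r ltz_pmod //; lia.
have Er : el a b - v%:~R * el al (ratio m) = el (a - v%:~R * al) (ratio r).
  rewrite -el_int elM elN elD; congr el; first by ring.
  rewrite Eb /ratio {1}(divz_eq k m) -/v -/r rmorphD rmorphM /=; field.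
  by rewrite intr_eq0.
have Ixr : integral (el (a - v%:~R * al) (ratio r)).
  rewrite -Er; apply: integral_sub; first exact: Ix.
  by apply: integral_mul; [exact: Iv|exact: Iw].
have rz : r = 0.
  apply/eqP; apply: contraT => rn0.
  have := minm `|r|%N; rewrite /P absz_gt0 rn0 gez0_abs //=.
  have -> : `[< exists a, integral (el a (ratio r)) >] by apply/asboolP; eexists; exact: Ixr.
  by move=> /(_ isT); lia.
have E0 : ratio r = 0 by rewrite rz /ratio mul0r.
have [|u Eu] := @integralOver_in_alg L (a - v%:~R * al).
  by move: Ixr; rewrite E0 /el scale0r mul0r addr0.
exists u, v; rewrite -[LHS](subrK (v%:~R * el al (ratio m))) Er E0 Eu el_int //.
Qed.

Let basis_el (al be : rat) : be != 0 -> basis_of {:L} [:: 1 : L; el al be].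
Proof.
move=> be0; rewrite basisEfree subvf /=.
have sp : ({:L} <= <<[:: (1 : L)%R; el al be]>>)%VS.
  apply/subvP => x _; have [a [b ->]] := elP x.
  have -> : el a b = (a - b / be * al) *: 1 + (b / be) *: el al be.
    rewrite -[X in _ + X]mulr_algl /el mulrDr mulrA -!algM addrA -algD.
    by congr (_ *: _ + _ *: _ * _); field.
  by rewrite rpredD // rpredZ // memv_span // !inE eqxx ?orbT.
apply/andP; split; last by rewrite (leq_trans (dimvS sp)) // dim_span.
rewrite free_cons span_seq1 seq1_free; apply/andP; split.
  apply/negP => /vlineP[k]; rewrite -mulr_algl /el mulrDr mulrA -!algM => E.
  have /el_eq0[] : el (k * al - 1) (k * be) = 0.
    by rewrite /el algD algN scale1r addrAC -E subrr.
  move=> + /eqP; rewrite mulf_eq0 (negPf be0) orbF => + /eqP k0.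
  by rewrite k0 mul0r sub0r => /eqP; rewrite oppr_eq0 oner_eq0.
by apply/negP => /eqP /el_eq0[_ /eqP]; rewrite (negPf be0).
Qed.

Let dimL : \dim {:L} = 2.
Proof. exact: (@size_basis _ _ _ _ [tuple 1 : L; el 0 1] (basis_el 0 (oner_neq0 _))). Qed.

(** Multiplication by [x] acting on coordinate row vectors; its trace is [field_trace x]. *)
Let mulmx_of (x : L) : 'M[rat]_(\dim {:L}) :=
  \matrix_(i, j) coord (vbasis {:L}) j (x * (vbasis {:L})`_i).

Let mulmx_ofM x y : mulmx_of (x * y) = mulmx_of y *m mulmx_of x.
Proof.
apply/matrixP => i j; rewrite !mxE -mulrA.
rewrite {1}(coord_vbasis (memvf (y * (vbasis {:L})`_i))) mulr_sumr linear_sum.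
by apply: eq_bigr => k _; rewrite !mxE -scalerAr linearZ.
Qed.

Let mulmx_of_alg (a : rat) : mulmx_of a%:A = a%:M.
Proof.
apply/matrixP => i j; rewrite !mxE mulr_algl linearZ /= coord_free; last first.
  exact: basis_free (vbasisP _).
by rewrite mulr_natr.
Qed.

Let field_trace_mx x : field_trace x = \tr (mulmx_of x).
Proof. by apply: eq_bigr => i _; rewrite mxE. Qed.

Let field_trace_el a b : field_trace (el a b) = 2 * a.
Proof.
have tz : field_trace z = 0.
  rewrite field_trace_mx; apply: (mxtrace_sqrt_nonsquare dimL nsq).
  by rewrite -mulmx_ofM -expr2 z2A mulmx_of_alg.
have t1 : field_trace (1 : L) = 2.
  have := field_trace_mx (1%:A); rewrite mulmx_of_alg mxtrace_scalar scale1r dimL => ->.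
  by [].
have trL c x y : field_trace (c *: x + y : L) = c * field_trace x + field_trace y.
  rewrite /field_trace mulr_sumr -big_split /=; apply: eq_bigr => i _.
  by rewrite mulrDl -scalerAl linearP.
have t0 : field_trace (0 : L) = 0.
  by rewrite /field_trace big1 // => i _; rewrite mul0r linear0.
by rewrite /el trL t1 mulr_algl -[b *: z]addr0 trL tz t0; ring.
Qed.

(** For the integral basis 1, w with w = al + be z, the trace form has determinant (2 be)^2 g, which
    is also u^2 - 4n for the trace u and norm n of w. *)
Lemma quadratic_discriminant :
  exists (t : rat) (D : int), [/\ t != 0, D%:~R = t ^+ 2 * g%:~R & is_discriminant L D].
Proof.
have [al [be [Iw be0 spanw]]] := integral_basis_exists.
have [[u Eu] [n En]] := integral_trace_norm Iw.
have ED : (u ^+ 2 - 4 * n)%:~R = (2 * be) ^+ 2 * g%:~R :> rat.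
  rewrite rmorphB /= rmorphXn /= rmorphM /= -Eu -En; ring.
exists (2 * be), (u ^+ 2 - 4 * n); split=> //; first by rewrite mulf_neq0.
have sz : size [:: 1 : L; el al be] == \dim {:L} by rewrite dimL.
exists (Tuple sz); first split.
- exact: basis_el.
- move=> x; split=> [/spanw[c [d ->]]|[c ->]].
    exists [ffun i : 'I_(\dim {:L}) => if val i == 0%N then c else d].
    under eq_bigr => i _ do rewrite ffunE.
    rewrite (@sum_ord2 _ _ (fun i =>
      [:: 1 : L; el al be]`_i *~ (if i == 0%N then c else d)) dimL) /=.
    by rewrite mulrzl.
  have Iint (k : int) : integral k%:~R by apply: (integral_id intr k).
  elim/big_ind: _ => [|y y' Iy Iy'|i _]; first exact: integral0.
    exact: integral_add.
  rewrite -mulrzr; apply: integral_mul; last exact: Iint.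
  case: i => [[|[|i]]] //= _; first exact: integral1.
  by rewrite nth_nil; exact: integral0.
rewrite (@det_ord2 _ _ (fun i j =>
  field_trace ([:: 1 : L; el al be]`_i * [:: 1 : L; el al be]`_j)) dimL) /=.
have -> : 1 = el 1 0 :> L by rewrite (el_int 1).
by rewrite !elM !field_trace_el ED; ring.
Qed.

End QuadraticField.

(** The discriminant is g times a rational square, so its 3-adic valuation is odd as well, hence
    nonzero. *)
Lemma discriminant_dvd3 (g : int) : odd (logn 3 `|g|) ->
  exists2 D : int, sqrt_field_discriminant g D & (3 %| D)%Z.
Proof.
move=> odd3.
have [L [h [s Es gen]]] := num_field_exists [:: sqrtC (g%:~R : algC)].
case: s Es gen => [|z [|]] // [Ez] gen.
have z2 : z ^+ 2 = g%:~R.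
  apply: (fmorph_inj h); rewrite rmorphXn /= Ez sqrtCK.
  by apply/esym/rmorph_int.
have genz : <<1; z>>%VS = {:L}%VS by rewrite -gen adjoin_cons adjoin_nil agenv_id.
have g0 : g != 0 by apply: contraTneq odd3 => ->.
have [t [D [t0 ED disc]]] := quadratic_discriminant odd3 z2 genz.
exists D; first by exists L, z.
have := logn_ratio (isT : prime 3) g0 t0 ED; rewrite odd3 => oddD.
rewrite -(absz_nat 3) -/(dvdn 3 `|D|).
case: (posnP (logn 3 `|D|)) oddD => [-> //|].
by rewrite logn_gt0 mem_primes => /and3P[].
Qed.

(** * Square classes *)

(** Dually, [b^T] lies in the row space of [V^T] as soon as the cokernel of [V^T] kills it, and the
    columns of that cokernel are, transposed, row relations [e] of [V]. *)
Lemma Fredholm (F : fieldType) (m n : nat) (V : 'M[F]_(m, n)) (b : 'cV[F]_m) :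
  (forall e : 'rV[F]_m, e *m V = 0 -> e *m b = 0) -> exists x : 'cV[F]_n, V *m x = b.
Proof.
move=> H; suff /submxP[x Ex] : (b^T <= V^T)%MS.
  by exists x^T; rewrite -[LHS]trmxK trmx_mul trmxK -Ex trmxK.
rewrite submxE; apply/eqP/trmx_inj; rewrite trmx_mul trmxK trmx0.
apply/row_matrixP => i; rewrite row_mul row0; apply: H.
by rewrite -row_mul -[X in row i X]trmxK trmx_mul trmxK mulmx_coker trmx0 row0.
Qed.

Lemma prod_logn (B n : nat) : (0 < n)%N -> (n <= B)%N ->
  n = (\prod_(l < B.+1) l ^ logn l n)%N.
Proof.
move=> n0 nB; rewrite -{1}(partnT n0) (widen_partn _ nB) big_mkord.
by apply: eq_bigl => i; rewrite inE.
Qed.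

Lemma square_of_even_logn (n : nat) : (0 < n)%N ->
  (forall l, prime l -> ~~ odd (logn l n)) -> exists m, n = (m ^ 2)%N.
Proof.
move=> n0 H; exists (\prod_(l < n.+1) l ^ (logn l n)./2)%N.
rewrite {1}(prod_logn n0 (leqnn n)).
rewrite (big_morph (fun x => x ^ 2)%N (fun x y => expnMn x y 2) (exp1n 2)).
apply: eq_bigr => l _; rewrite -expnM muln2; congr (_ ^ _)%N.
rewrite -{1}[logn l n]odd_double_half.
have [/H/negPf-> //|] := boolP (prime l).
by rewrite lognE => /negPf->.
Qed.

Lemma F2_nat (n : nat) : n%:R = (odd n)%:R :> 'F_2.
Proof. by apply/val_inj; rewrite /= !val_Fp_nat // modn2; case: odd. Qed.

Lemma F2_nat_eq0 (n : nat) : (n%:R == 0 :> 'F_2) = ~~ odd n.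
Proof. by rewrite F2_nat; case: odd. Qed.

(* Row i records the squareclass of g i: column 0 is the sign, column l is the parity
   of the exponent of the prime l. *)
Definition squareclass (s B : nat) (g : 'I_s -> int) : 'M['F_2]_(s, B.+1) :=
  \matrix_(i < s, l < B.+1)
    (if val l == 0%N then ((g i < 0)%R : nat)%:R else (logn l `|g i|)%:R).

Lemma perfect_square_squareclass (s B : nat) (g : 'I_s -> int) (e : 'I_s -> bool) :
  (forall i, g i != 0) -> (forall i, (`|g i| <= B)%N) ->
  (\row_i (e i)%:R : 'rV['F_2]_s) *m squareclass B g = 0 ->
  perfect_square (\prod_(i < s) g i ^+ e i).
Proof.
move=> g0 gB H.
have HH l : (l < B.+1)%N ->
    ~~ odd (\sum_i e i * (if l == 0%N then (g i < 0)%R : nat else logn l `|g i|))%N.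
  move=> lB; rewrite -F2_nat_eq0 natr_sum; have /rowP/(_ (Ordinal lB)) := H.
  rewrite !mxE => E; apply/eqP; rewrite -[RHS]E; apply: eq_bigr => i _.
  by rewrite !mxE natrM; case: ifP.
have P (r : seq 'I_s) : let y := \prod_(i <- r) g i ^+ e i in
  [/\ y != 0, (y < 0) = odd (\sum_(i <- r) e i * (g i < 0)%R)%N &
   forall l, logn l `|y| = (\sum_(i <- r) e i * logn l `|g i|)%N].
  elim: r => [|i r [y0 ys yl]] /=.
    by rewrite !big_nil; split=> // l; rewrite big_nil absz1 logn1.
  rewrite !big_cons; split.
  - by rewrite mulf_neq0 // expf_neq0.
  - rewrite oddD -ys; case: (e i); rewrite ?expr0 ?expr1 ?mul1r ?mul1n ?mul0n //=.
    by have := g0 i; have := y0; set y := \prod_(_ <- _) _; nia.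
  - move=> l; rewrite big_cons -yl abszM lognM ?absz_gt0 ?expf_neq0 //.
    by case: (e i); rewrite ?expr0 ?expr1 ?absz1 ?logn1 ?mul1n ?mul0n.
have [] := P (index_enum _); set y := \prod_(_ <- _) _ => y0 ys yl.
have y_ge0 : 0 <= y by rewrite leNgt ys; have := HH 0%N isT.
have [|l pr_l|m Em] := @square_of_even_logn `|y|%N; first by rewrite absz_gt0.
  (* A prime beyond [B] has no column, but it divides no [g i]. *)
  have [lB|lB] := ltnP l B.+1; first by rewrite yl; have := HH l lB; case: l pr_l {lB}.
  rewrite yl big1 // => i _; rewrite [X in (_ * X)%N](_ : _ = 0%N) ?muln0 //.
  apply/eqP; rewrite -leqn0 leqNgt logn_gt0 mem_primes pr_l absz_gt0 g0 /=.
  apply/negP => /dvdn_leq; rewrite absz_gt0 g0 => /(_ isT).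
  by have := gB i; lia.
by exists m%:Z; rewrite -[LHS]gez0_abs // Em expr2 -PoszM mulnn.
Qed.

(* (-1) ^ x l is the value to be prescribed for the symbol (l/p), resp. (-1/p) if l = 0. *)
Lemma sign_assignment (s B : nat) (g : 'I_s -> int) :
  (forall i, g i != 0) -> (forall i, (`|g i| <= B)%N) ->
  (forall e : 'I_s -> bool, odd (\sum_(i < s) e i)%N ->
     ~ perfect_square (\prod_(i < s) g i ^+ e i)) ->
  exists x : nat -> bool, forall i,
    odd ((g i < 0)%R * x 0%N + \sum_(1 <= l < B.+1) logn l `|g i| * x l)%N.
Proof.
move=> g0 gB hsq.
have F2E (a : 'F_2) : a = (a == 1)%:R.
  by case: a => [[|[|]]] //= lt; exact: val_inj.
(* The right-hand side is 1 in every row because each [g i] is to be a nonresidue. A relation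
   between rows makes a product of the [g i] a square, so by [hsq] it involves an even number of
   rows and kills the all-ones column. *)
have [e eV|x Ex] := @Fredholm _ _ _ (squareclass B g) (const_mx 1).
  have eb : e = \row_i (e 0 i == 1)%:R by apply/rowP => i; rewrite mxE -F2E.
  have : ~~ odd (\sum_i (e 0%R i == 1%R))%N.
    apply/negP => /hsq; apply; apply: (perfect_square_squareclass g0 gB).
    by rewrite -eb.
  rewrite -F2_nat_eq0 natr_sum => /eqP E; apply/matrixP => i j.
  by rewrite !mxE -[RHS]E; apply: eq_bigr => k _; rewrite mxE mulr1 ord1 -F2E.
exists (fun l => x (inord l) 0 == 1) => i.
set n := (_ + _)%N; suff : n%:R = 1 :> 'F_2 by rewrite F2_nat; case: odd.
have /colP/(_ i) := Ex; rewrite !mxE big_ord_recl => E; rewrite -[RHS]E.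
rewrite /n natrD natrM -F2E mxE /= natr_sum big_add1 big_mkord.
rewrite (_ : inord 0 = ord0); last by apply/val_inj; rewrite /= inordK.
congr (_ + _); apply: eq_bigr => l _; rewrite natrM mxE -F2E /=.
by rewrite (_ : inord _ = lift ord0 l) //; apply/val_inj; rewrite /= inordK ?ltnS.
Qed.

(** * Primitive roots and residue classes *)

(** A prime factor of the cofactor of d would be 2 or q; the first forces d to divide
    [2 ^ a.-1 * q], the second [2 ^ a]. *)
Lemma order_eq_twopow_prime (d a q : nat) : prime q ->
  (d %| 2 ^ a * q)%N -> ~~ (d %| 2 ^ a)%N -> ~~ (d %| 2 ^ a.-1 * q)%N -> d = (2 ^ a * q)%N.
Proof.
move=> pr_q /dvdnP[e Ee] n1 n2.
have q0 := prime_gt0 pr_q.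
have e0 : (0 < e)%N.
  case: e Ee => // /eqP.
  rewrite mul0n muln_eq0 expn_eq0 /= => /eqP q00.
  by rewrite q00 in q0.
have [e1|e1] := eqVneq e 1%N; first by rewrite Ee e1 mul1n.
have pr_l := pdiv_prime (_ : 1 < e)%N; have {}pr_l : prime (pdiv e) by apply: pr_l; lia.
have /dvdnP[f Ef] := pdiv_dvd e; move: pr_l Ef; set l := pdiv e => pr_l Ef.
have : (l %| 2 ^ a * q)%N by rewrite Ee Ef dvdn_mulr // dvdn_mull.
rewrite Euclid_dvdM // => /orP[|].
  rewrite Euclid_dvdX // => /andP[]; rewrite dvdn_prime2 // => /eqP l2 a0.
  case/negP: n2; apply/dvdnP; exists f; apply/eqP; rewrite -(eqn_pmul2l (isT : (0 < 2)%N)).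
  by rewrite mulnA -expnS prednK // Ee Ef l2 -mulnA mulnCA.
rewrite dvdn_prime2 // => /eqP lq.
case/negP: n1; apply/dvdnP; exists f; apply/eqP; rewrite -(eqn_pmul2r q0) Ee Ef lq.
by rewrite mulnAC.
Qed.

Lemma primitive_root_of_nonresidue (g : int) (p a q : nat) : prime p -> prime q ->
  p = (2 ^ a * q).+1 -> (0 < a)%N ->
  g%:~R ^+ p./2 = -1 :> 'F_p -> g%:~R ^+ (2 ^ a) != 1 :> 'F_p ->
  primitive_root_mod g p.
Proof.
move=> pr_p pr_q Ep a0 gh ga.
have Eh : p./2 = (2 ^ a.-1 * q)%N.
  by rewrite Ep -(prednK a0) expnS -mulnA mul2n /= uphalf_double.
have Ep1 : p.-1 = (2 ^ a * q)%N by rewrite Ep.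
have odd_p : odd p by rewrite Ep /= oddM oddX /= eqn0Ngt a0.
have g0 : g%:~R != 0 :> 'F_p.
  apply: contra_eq_neq gh => ->; rewrite expr0n eqn0Ngt half_odd_prime_gt0 //.
  by rewrite eq_sym oppr_eq0 oner_neq0.
have gU : g%:~R \is a @GRing.unit 'F_p by rewrite unitfE.
pose u := FinRing.unit 'F_p gU; exists u => //.
have uX n : (u ^+ n == 1)%g = (g%:~R ^+ n == 1 :> 'F_p).
  by rewrite -val_eqE /= FinRing.val_unitX.
have Eu : #[u]%g = (2 ^ a * q)%N.
  apply: order_eq_twopow_prime => //.
  - have := order_dvdG (finset.in_setT u); rewrite card_finField_unit card_Fp //.
    by rewrite Ep1.
  - by rewrite order_dvdn uX.
  - by rewrite order_dvdn uX -Eh gh Fp_N1_neq1.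
rewrite /generator eq_sym eqEcard finset.subsetT card_finField_unit card_Fp //.
by rewrite -orderE Eu Ep1 leqnn.
Qed.

Lemma Fp_sign_of_exponents (g : int) (p B : nat) (x : nat -> bool) :
  prime p -> odd p -> g != 0 -> (`|g| <= B)%N -> (3 < p)%N ->
  ~~ odd (logn 3 `|g|) ->
  (-1) ^+ p./2 = (-1) ^+ x 0%N :> 'F_p ->
  (forall l, prime l -> (l <= B)%N -> l != 3 -> l%:R ^+ p./2 = (-1) ^+ x l :> 'F_p) ->
  odd ((g < 0)%R * x 0%N + \sum_(1 <= l < B.+1) logn l `|g| * x l)%N ->
  g%:~R ^+ p./2 = -1 :> 'F_p.
Proof.
move=> pr_p odd_p g0 gB p3 even3 hN1 hl hodd.
have Eg : g%:~R = (-1) ^+ (g < 0)%R * (`|g|%N)%:R :> 'F_p.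
  by rewrite {1}(intEsign g) rmorphM /= rmorph_sign.
rewrite Eg exprMn -exprM mulnC exprM hN1 -exprM (mulnC _ (_ < _)%R).
rewrite -[RHS](_ : (-1) ^+ true = _) // -hodd signr_odd exprD; congr (_ * _).
rewrite {1}(@prod_logn B `|g|%N) ?absz_gt0 // -(big_mkord xpredT (fun l => l ^ logn l `|g|)%N).
rewrite [X in X%:R]big_ltn // [logn 0 _]lognE expn0 mul1n natr_prod -prodrXl expr_sum.
rewrite !big_seq; apply: eq_bigr => l.
rewrite mem_index_iota ltnS => /andP[_ lB]; rewrite natrX exprAC.
have [pr_l|npr] := boolP (prime l); last by rewrite lognE (negPf npr) mul0n !expr0.
(* No relation between [x 3] and (3/p) is available: both signs occur to an even power. *)
have [l3|l3] := eqVneq l 3.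
  have h3 : (3%:R : 'F_p) ^+ p./2 ^+ 2 = 1.
    have : (3%:R : 'F_p) != 0 by rewrite Fp_nat_eq0 // dvdn_prime2 // neq_ltn p3 orbT.
    by move/(Fp_expf_half pr_p odd_p) => /orP[] /eqP ->; rewrite ?sqrrN expr1n.
  rewrite l3 -(signr_odd _ (_ * _)) oddM (negPf even3) /=.
  by rewrite -(even_halfK even3) -mul2n exprM h3 expr1n.
by rewrite hl // -exprM mulnC.
Qed.

(** * Choice of the residue class and local admissibility *)

Lemma residue_choice (l : nat) (b : bool) : prime l -> odd l ->
  exists r : nat, [/\ ~~ (r == 0 %[mod l])%N, ~~ (r == 1 %[mod l])%N &
    l != 3 -> qchar (r%:R : 'F_l) = (-1) ^+ b].
Proof.
move=> pr_l odd_l.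
have l3 : (3 <= l)%N by case: l pr_l odd_l => [|[|[]]].
have [E|l3'] := eqVneq l 3%N; first by exists 2%N; rewrite E.
have neq0 n : (n == 0 %[mod l])%N = (n%:R == 0 :> 'F_l) by rewrite Fp_nat_eq0 // mod0n.
have neq1 n : (n == 1 %[mod l])%N = (n%:R == 1 :> 'F_l).
  have v k : val (k%:R : 'F_l) = (k %% l)%N := val_Fp_nat pr_l k.
  by rewrite -[X in _ = (_ == X)]/(1%:R) -val_eqE !v.
case: b.
  have [a a0 Ea] := Fp_nonresidue pr_l odd_l; exists a; rewrite neq0 neq1 natr_Zp.
  split=> //; apply: contra_eqN Ea => /eqP->.
  by rewrite /qchar oner_eq0 expr1n eqxx.
have h2 : (2%:R : 'F_l) != 0.
  by rewrite Fp_nat_eq0 //; apply/negP => /(dvdn_leq (isT : (0 < 2)%N)); lia.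
have E4 : 4%:R = 2%:R * 2%:R :> 'F_l by rewrite -natrM.
exists 4%N; rewrite neq0 neq1; split=> //.
- by rewrite E4 mulf_neq0.
- have E3 : 4%:R - 1 = 3%:R :> 'F_l by ring.
  by rewrite -subr_eq0 E3 Fp_nat_eq0 //; apply/negP => /(dvdn_leq (isT : (0 < 3)%N)); lia.
- by rewrite E4 qcharM // -expr2 qchar_sqr.
Qed.

Lemma coprime_prodr (m : nat) (ms : seq nat) :
  all (coprime m) ms -> coprime m (\prod_(k <- ms) k).
Proof.
elim: ms => [|k ms IH] /=; first by rewrite big_nil coprimen1.
by case/andP => co /IH coms; rewrite big_cons coprimeMr co.
Qed.

Lemma chinese_seq (ms : seq nat) (f : nat -> nat) : pairwise coprime ms ->
  exists c, forall m, m \in ms -> c = f m %[mod m].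
Proof.
elim: ms => [|m ms IH] /=; first by exists 0%N.
case/andP => /coprime_prodr cop /IH[c Ec].
exists (chinese m (\prod_(k <- ms) k) (f m) c) => k; rewrite inE => /orP[/eqP->|kms].
  by rewrite chinese_modl.
rewrite -(Ec k kms).
have /(congr1 (modn^~ k)) := chinese_modr cop (f m) c.
by rewrite /= !modn_dvdm // (big_rem k) //= dvdn_mulr.
Qed.

Lemma infinite_set_int_unbounded (S : set int) (K : nat) :
  infinite_set S -> exists2 n, S n & (K < `|n|)%N.
Proof.
move=> infS; apply: contrapT => H; apply: infS.
apply: (@sub_finite_set _ _ [set (i : nat)%:Z - K%:Z | i in `I_(K.*2.+1)]%classic).
  move=> n Sn; have nK : (`|n| <= K)%N.
    by rewrite leqNgt; apply/negP => h; apply: H; exists n.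
  exists (absz (n + K%:Z)); first by rewrite /=; lia.
  by lia.
by apply: finite_image; apply: finite_II.
Qed.

(** Each factor has a single root mod p, and k < p roots do not exhaust ['F_p]. *)
Lemma avoid_roots (k p : nat) (A B : 'I_k -> int) : prime p -> (k < p)%N ->
  (forall j, ~~ (p%:Z %| A j)%Z) ->
  exists n : int, ~~ (p%:Z %| \prod_(j < k) (A j * n + B j))%Z.
Proof.
move=> pr_p kp nA.
pose r (j : 'I_k) : 'F_p := - (B j)%:~R / (A j)%:~R.
have [n nr] : exists n : 'F_p, n \notin codom r.
  apply/existsP; rewrite -negb_forall; apply/negP => /forallP H.
  have : (#|'F_p| <= #|'I_k|)%N.
    rewrite -(size_codom r); apply: leq_trans (card_size _).
    by apply/subset_leq_card/fintype.subsetP => n _; apply: H.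
  by rewrite card_Fp // card_ord leqNgt kp.
exists (n : nat)%:Z; rewrite (dvdz_pcharf (pchar_Fp pr_p)) rmorph_prod prodf_seq_neq0.
apply/allP => j _ /=; have A0 : (A j)%:~R != 0 :> 'F_p.
  by rewrite -(dvdz_pcharf (pchar_Fp pr_p)).
rewrite rmorphD rmorphM /= -pmulrn natr_Zp; apply: contraNneq nr => E.
apply/codomP; exists j; rewrite /r; apply: (mulIf A0); rewrite mulfVK //.
by rewrite mulrC; apply/eqP; rewrite -addr_eq0 E.
Qed.

(** The class mod 8 determines both signs; the class 1 mod 8 is refined to 9 mod 16 so that the
    exact power of 2 in p - 1 is fixed too. *)
Lemma residue_mod16 (x0 x2 : bool) : exists a r : nat,
  [/\ (0 < a <= 3)%N,
    forall c, c = r %[mod 16] -> exists2 c', c = (2 ^ a * c').+1 & odd c' &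
    forall p, p = r %[mod 16] ->
      [/\ odd p, odd p./2 = x0 & (p %% 8 \in [:: 3; 5])%N = x2]].
Proof.
case: x0; case: x2; [exists 1%N, 3%N | exists 1%N, 7%N | exists 2%N, 5%N | exists 3%N, 9%N];
  split=> // [c cr|p pr].
- by exists ((c - 1) %/ 2)%N; lia.
- by rewrite !inE; split; lia.
- by exists ((c - 1) %/ 2)%N; lia.
- by rewrite !inE; split; lia.
- by exists ((c - 1) %/ 4)%N; lia.
- by rewrite !inE; split; lia.
- by exists ((c - 1) %/ 8)%N; lia.
- by rewrite !inE; split; lia.
Qed.

Lemma prime_dvd_prodr (l : nat) (ms : seq nat) : prime l ->
  (l %| \prod_(m <- ms) m)%N -> exists2 m, m \in ms & (l %| m)%N.
Proof.
move=> pr_l; elim: ms => [|m ms IH].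
  by rewrite big_nil dvdn1 => /eqP l1; rewrite l1 in pr_l.
rewrite big_cons Euclid_dvdM // => /orP[lm|/IH[k kms lk]].
  by exists m; rewrite ?inE ?eqxx.
by exists k; rewrite ?inE ?kms ?orbT.
Qed.

Lemma admissible_class (B : nat) (x : nat -> bool) : exists M a c : nat,
  [/\ (0 < a <= 3)%N, (0 < M)%N /\ (2 ^ a.+1 %| M)%N,
    exists2 c', c = (2 ^ a * c').+1 & odd c',
    (forall l, prime l -> (l <= B)%N -> (l %| M)%N) /\
    (forall l, prime l -> odd l -> (l %| M)%N ->
      ~~ (c == 0 %[mod l])%N /\ ~~ (c == 1 %[mod l])%N) &
    forall p, prime p -> p = c %[mod M] -> (B < p)%N ->
      [/\ odd p, (-1) ^+ p./2 = (-1) ^+ x 0%N :> 'F_p &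
        forall l, prime l -> (l <= B)%N -> l != 3 -> l%:R ^+ p./2 = (-1) ^+ x l :> 'F_p]].
Proof.
have [a [r [a3 rc rp]]] := residue_mod16 (x 0%N) (x 2).
pose ls := [seq l <- iota 0 B.+1 | prime l && odd l].
have lsP l : (l \in ls) = [&& prime l, odd l & (l <= B)%N].
  by rewrite mem_filter mem_iota add0n ltnS /= andbA.
(* Reciprocity reads (l/p) = (p/l) (-1/p)^((l-1)/2); the term [odd l./2 && x 0%N] accounts for the
   last factor. *)
have /choice[f Hf] (l : nat) : exists r : nat, prime l && odd l ->
    [/\ ~~ (r == 0 %[mod l])%N, ~~ (r == 1 %[mod l])%N &
    l != 3 -> qchar (r%:R : 'F_l) = (-1) ^+ (x l (+) (odd l./2 && x 0%N))].
  have [/andP[pr_l odd_l]|] := boolP (prime l && odd l); last by exists 0%N.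
  by have [k Hk] := residue_choice (x l (+) (odd l./2 && x 0%N)) pr_l odd_l; exists k.
pose ms := 16%N :: ls.
have co : pairwise coprime ms.
  rewrite /ms /=; apply/andP; split.
    apply/allP => l; rewrite lsP => /and3P[_ odd_l _].
    by rewrite (@coprime_pexpl 4 2 l) // coprime2n.
  have : uniq ls by rewrite filter_uniq ?iota_uniq.
  have : all prime ls by apply/allP => l; rewrite lsP => /and3P[].
  elim: (ls) => [|l s IH] //= /andP[pr_l pr_s] /andP[lns us]; rewrite IH // andbT.
  apply/allP => k ks; rewrite prime_coprime // dvdn_prime2 //; last exact: (allP pr_s).
  by apply: contraNneq lns => ->.
have [c Hc] := chinese_seq (fun m => if m == 16%N then r else f m) co.
have c16 : c = r %[mod 16] by apply: (Hc 16%N); rewrite inE eqxx.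
have cl l : l \in ls -> c = f l %[mod l].
  move=> lls; have := Hc l; rewrite inE lls orbT => /(_ isT).
  by case: eqP => // l16; move: lls; rewrite lsP l16.
have dvM m : m \in ms -> (m %| \prod_(m <- ms) m)%N.
  by move=> mms; rewrite (big_rem m) //= dvdn_mulr.
have ms0 : (0 < \prod_(m <- ms) m)%N.
  rewrite big_seq prodn_cond_gt0 // => m; rewrite inE => /orP[/eqP->//|].
  by rewrite lsP => /andP[/prime_gt0].
exists (\prod_(m <- ms) m)%N, a, c; split=> //; first split=> //.
- apply: (@dvdn_trans 16); last by apply: dvM; rewrite inE eqxx.
  by rewrite (@dvdn_exp2l 2 a.+1 4) //; lia.
- exact: rc.
- split=> [l pr_l lB|l pr_l odd_l].
    have [odd_l|ev_l] := boolP (odd l).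
      by apply: dvM; rewrite inE lsP pr_l odd_l lB orbT.
    have -> : l = 2%N by case: (even_prime pr_l) => // odd_l; rewrite odd_l in ev_l.
    by apply: (@dvdn_trans 16) => //; apply: dvM; rewrite inE eqxx.
  case/(prime_dvd_prodr pr_l) => m mms lm.
  have lls : l \in ls.
    move: mms; rewrite inE => /orP[/eqP m16|].
      move: lm; rewrite m16 (@Euclid_dvdX 2 4) // dvdn_prime2 // => /andP[/eqP l2 _].
      by rewrite l2 in odd_l.
    move=> mls; have := mls; rewrite {1}lsP => /and3P[pr_m _ _].
    by move: lm; rewrite dvdn_prime2 // => /eqP->.
  rewrite (cl l lls); have [|H0 H1 _] := Hf l; first by rewrite pr_l odd_l.
  by split.
move=> p pr_p pc Bp.
have p16 : p = r %[mod 16].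
  have d16 : (16 %| \prod_(m <- ms) m)%N by apply: dvM; rewrite inE eqxx.
  by rewrite -c16 -(modn_dvdm p d16) pc modn_dvdm.
have [odd_p px0 px2] := rp p p16.
have N1 : (-1) ^+ p./2 = (-1) ^+ x 0%N :> 'F_p by rewrite -signr_odd px0.
split=> // l pr_l lB l3.
have [odd_l|ev_l] := boolP (odd l); last first.
  have -> : l = 2%N by case: (even_prime pr_l) => // odd_l; rewrite odd_l in ev_l.
  by rewrite euler_two // px2.
have lls : l \in ls by rewrite lsP pr_l odd_l.
have dl : (l %| \prod_(m <- ms) m)%N by apply: dvM; rewrite inE lls orbT.
have pl : p%:R = (f l)%:R :> 'F_l.
  by rewrite -(Fp_nat_mod pr_l p) -(modn_dvdm p dl) pc modn_dvdm // cl // Fp_nat_mod.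
have := quadratic_reciprocity pr_p pr_l odd_p odd_l (_ : p != l).
rewrite gtn_eqF ?(leq_ltn_trans lB) // => /(_ isT).
have [|_ _ /(_ l3) E] := Hf l; first by rewrite pr_l odd_l.
rewrite pl E rmorph_sign signr_addb exprMn -exprM mulnC exprM N1 => H.
apply: (mulfI (_ : (-1) ^+ (odd l./2 && x 0%N) != 0 :> 'F_p)); first by rewrite signr_eq0.
rewrite [RHS]mulrC -H; congr (_ * _).
by rewrite -exprM mulnC -(signr_odd _ (_ * _)) oddM oddb.
Qed.

(** * Application of the tuplets conjecture *)

Theorem theorem3 (N : nat) (hN : (1 <= N)%N) (hTC : TC (2 * N)%N)
    (s : nat) (hs : (1 <= s)%N) (g : 'I_s -> int)
    (hg : forall i : 'I_s, [/\ g i <> -1, g i <> 0 & g i <> 1])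
    (hsq : forall e : 'I_s -> bool, odd (\sum_(i < s) e i)%N ->
       ~ perfect_square (\prod_(i < s) g i ^+ e i))
    (hdisc : forall (i : 'I_s) (D : int),
       sqrt_field_discriminant (g i) D -> ~~ (3 %| D)%Z) :
  exists A C : int, forall j : nat, (1 <= j <= N)%N ->
    primez (A * j%:Z ^+ 2 + C) /\
    forall i : 'I_s, primitive_root_mod (g i) (absz (A * j%:Z ^+ 2 + C)).
Proof.
have g0 i : g i != 0 by apply/eqP; case: (hg i).
(* [B] is at least 2N, the number of forms, and at least every |g i|, hence every prime dividing
   some [g i]. *)
pose G := (\sum_(i < s) `|g i|)%N; pose B := (2 * N + G)%N.
have gG i : (`|g i| <= G)%N by rewrite /G (bigD1 i) //= leq_addr.
have gB i : (`|g i| <= B)%N by rewrite (leq_trans (gG i)) // leq_addl.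
have [x Hx] := sign_assignment g0 gB hsq.
have [M [a [c [/andP[a0 a3] [M0 dvM] [c' Ec odd_c'] [MB Mc] Hp]]]] := admissible_class B x.
(* M' = M / 2^a is even, so M' t + c' stays odd. *)
have /dvdnP[M2 EM2] := dvM; pose M' := (2 * M2)%N.
have EM : M = (2 ^ a * M')%N by rewrite EM2 /M' expnS; lia.
have M'0 : (0 < M')%N by move: M0; rewrite EM muln_gt0 => /andP[].
have EM' t : (M * t + c = (2 ^ a * (M' * t + c')).+1)%N by rewrite EM Ec; lia.
(* Index j - 1 carries the form for p(j), index N + j - 1 the form for (p(j) - 1) / 2^a. *)
pose idx (k : 'I_(2 * N)) := if (k < N)%N then k.+1 else (k - N).+1.
pose Ak (k : 'I_(2 * N)) : nat := if (k < N)%N then M else M'.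
pose Bk (k : 'I_(2 * N)) : nat :=
  if (k < N)%N then (M * idx k ^ 2 + c)%N else (M' * idx k ^ 2 + c')%N.
have posA k : 0 < (Ak k)%:Z by rewrite /Ak; case: ifP.
have adm (l : nat) : prime l ->
    exists n : int, ~~ (l%:Z %| \prod_(k < 2 * N) ((Ak k)%:Z * n + (Bk k)%:Z))%Z.
  move=> pr_l.
  have [lM|lnM] := boolP (l %| M)%N.
    (* Modulo a prime l dividing M take n = 0. For odd l, the forms for p(j) are c mod l, and l
       dividing one of the others would give c = 1 mod l; for l = 2 all values are odd. *)
    exists 0; rewrite (dvdz_pcharf (pchar_Fp pr_l)) rmorph_prod prodf_seq_neq0.
    apply/allP => k _ /=; rewrite mulr0 add0r -pmulrn Fp_nat_eq0 // /Bk.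
    have odd_case : odd l -> ~~ (l %| M * idx k ^ 2 + c)%N /\ ~~ (l %| M' * idx k ^ 2 + c')%N.
      move=> odd_l; have [c0 c1] := Mc l pr_l odd_l lM.
      have lMt : (l %| M * idx k ^ 2)%N by rewrite dvdn_mulr.
      split; first by rewrite dvdn_addr // /dvdn; move: c0; rewrite mod0n.
      apply: contra c1 => lv.
      have lv' : (l %| 2 ^ a * (M' * idx k ^ 2 + c'))%N by rewrite dvdn_mull.
      have := congr1 (modn^~ l) (etrans (EM' (idx k ^ 2)%N) (esym (addn1 _))).
      by rewrite /= -modnDml (eqP lMt) add0n => ->; rewrite -modnDml (eqP lv') add0n.
    have [odd_l|ev_l] := boolP (odd l); first by case: (odd_case odd_l); case: ifP.
    have -> : l = 2%N by case: (even_prime pr_l) => // odd_l; rewrite odd_l in ev_l.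
    case: ifP => _; rewrite dvdn2 negbK.
      by rewrite EM' /= oddM oddX /= eqn0Ngt a0.
    by rewrite oddD oddM odd_c' /M' oddM.
  have lB : (B < l)%N by rewrite ltnNge; apply: contra lnM; apply: MB.
  apply: avoid_roots => // [|k]; first by apply: leq_ltn_trans lB; rewrite /B leq_addr.
  rewrite /Ak; case: ifP => _; rewrite -[(_ %| _)%Z]/(l %| _)%N //.
  by apply: contra lnM; rewrite EM; apply: dvdn_mull.
(* The term c serves to exclude negative n, while G^8, 3 and B make p exceed every |g i|^(2^a) (as a
   <= 3), the prime 3, and B. *)
have [n Hn nK] := infinite_set_int_unbounded (c + G ^ 8 + 3 + B)%N (hTC _ _ posA adm).
(* A negative n of this size would make the first form negative, contrary to [primez]. *)
have n0 : 0 <= n.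
  have lt0 : (0 < 2 * N)%N by rewrite muln_gt0.
  have := Hn (Ordinal lt0); rewrite /Ak /Bk /idx /= hN /primez => /andP[pos _].
  rewrite leNgt; apply/negP => nneg.
  nia.
case: n n0 Hn nK => // n _ Hn nK; rewrite /= in nK.
exists M%:Z, (M * n + c)%N%:Z => j /andP[j1 jN].
have -> : M%:Z * j%:Z ^+ 2 + (M * n + c)%N%:Z = (M * (n + j ^ 2) + c)%N%:Z :> int by lia.
set p := (M * (n + j ^ 2) + c)%N; rewrite /=.
have ltp : (j.-1 < 2 * N)%N by lia.
have ltq : (N + j.-1 < 2 * N)%N by lia.
have : primez p%:Z.
  have := Hn (Ordinal ltp); rewrite /Ak /Bk /idx /= prednK // jN.
  by congr primez; rewrite /p; lia.
have : primez (M' * (n + j ^ 2) + c')%N%:Z.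
  have := Hn (Ordinal ltq); rewrite /Ak /Bk /idx /= ltnNge leq_addr /= addKn prednK //.
  by congr primez; lia.
move=> /andP[_ /= pr_q] pzp; split=> // i; move: pzp => /andP[_ /= pr_p].
have np : (n <= p)%N by rewrite /p; nia.
have Bp : (B < p)%N by lia.
have [|odd_p hN1 hl] := Hp p pr_p _ Bp.
  by rewrite /p mulnC modnMDl.
apply: (primitive_root_of_nonresidue pr_p pr_q _ a0); first exact: EM'.
  apply: (Fp_sign_of_exponents pr_p odd_p (g0 i) (gB i) _ _ hN1 hl (Hx i)); first by lia.
  apply/negP => /discriminant_dvd3[D /hdisc /negP].
  by [].
(* As |g i| >= 2, the integer g^(2^a) - 1 is nonzero, and its absolute value is at most G^8 + 1 <
   p. *)
rewrite -rmorphXn -subr_eq0 -[1]/(1%:~R) -rmorphB /= -(dvdz_pcharf (pchar_Fp pr_p)).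
have [gN1 _ g1] := hg i; have gi0 := g0 i.
have g_ge2 : (1 < `|g i|)%N by lia.
have gX : (1 < `|g i ^+ (2 ^ a)| <= G ^ 8)%N.
  rewrite abszX -{1}(exp1n (2 ^ a)) ltn_exp2r ?expn_gt0 // g_ge2 /=.
  apply: leq_trans (_ : `|g i| ^ 8 <= _)%N; last by rewrite leq_exp2r.
  by rewrite leq_exp2l // (@leq_exp2l 2 a 3).
rewrite -[(_ %| _)%Z]/(p %| _)%N; apply/negP => /dvdn_leq.
move: gX; move: (g i ^+ (2 ^ a)) => y gX dl.
have y1 : (0 < `|(y - 1)%R|)%N by lia.
by have := dl y1; lia.
Qed.
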